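(* Consider the FOTD iterates $\{(z^\tau,\lambda^\tau)\}_\tau$ and suppose the reduced-Hessian, controllability, upper-boundedness, compactness, vanishing-Hessian-modification and local-Lipschitz assumptions stated in the context hold, that $\mu\ge\bar\mu:=32\,\Upsilon_{upper}^{4t+1}/\gamma_C$, and that $\eta_1\ge17/(\eta_2\gamma_G)$, $\eta_2\le\gamma_{RH}/(12\Upsilon^2)$. Let $C_1>0$ and $\rho\in(0,1)$ be constants, independent of $\tau,\eta_1,\eta_2,\beta$ (their existence is guaranteed under these hypotheses), such that whenever $$b\ge\frac{\log\{(3/2-\beta)C_1\eta_1/((1/2-\beta)\eta_2)\}}{\log(1/\rho)}\qquad( * )$$ one has for all sufficiently large $\tau$: for every $i\in[M-2]$, $k\in[n_i,n_{i+1})$, $$\Psi_k^{\tau+1}\le o(\Psi^\tau)+C_1\left\{\rho^{k-m_1}\|x_{m_1}^\tau-x_{m_1}^\star\|+\rho^{m_2-k}\left\|\begin{pmatrix}z_{m_2}^\tau-z_{m_2}^\star\\ \lambda_{m_2+1}^\tau-\lambda_{m_2+1}^\star\end{pmatrix}\right\|\right\},$$ and for every $k\in[n_{M-1},n_M]$ (with $m_1=m_1^{M-1}$), $\Psi_k^{\tau+1}\le o(\Psi^\tau)+C_1\rho^{k-m_1}\|x_{m_1}^\tau-x_{m_1}^\star\|$. Then, if $b$ satisfies $( * )$, for all sufficiently large $\tau$, $$\Psi^{\tau+1}\le3C_1\rho^b\cdot\Psi^\tau.$$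
   Context: $[n]=\{0,\dots,n\}$; intervals of stages denote sets of integers. Consider the nonlinear dynamic program $\min\sum_{k=0}^{N-1}g_k(x_k,u_k)+g_N(x_N)$ s.t. $x_{k+1}=f_k(x_k,u_k)$, $k\in[N-1]$, $x_0=\bar x_0$, with $x_k\in\mathbb{R}^{n_x}$, $u_k\in\mathbb{R}^{n_u}$. Write $z_k=(x_k;u_k)$ ($k<N$), $z_N=x_N$, $z=(z_0;\dots;z_N)$, $f(z)=(x_0-\bar x_0;x_1-f_0(z_0);\dots;x_N-f_{N-1}(z_{N-1}))$, $g(z)$ the objective, $\lambda=(\lambda_0;\dots;\lambda_N)$ with $\lambda_k\in\mathbb{R}^{n_x}$, $\mathcal{L}(z,\lambda)=g(z)+\lambda^Tf(z)$, $\nabla\mathcal{L}=(\nabla_z\mathcal{L};\nabla_\lambda\mathcal{L})$. $G(z)$ is the Jacobian of $f$; $A_k(z_k),B_k(z_k)$ are the Jacobians of $f_k$ w.r.t. $x_k,u_k$. $H(z,\lambda)=\nabla_z^2\mathcal{L}=\mathrm{diag}(H_0,\dots,H_N)$, where $H_k$ depends on $(z_k,\lambda_{k+1})$ for $k<N$ and $H_N$ on $z_N$ only. Superscript $\tau$ denotes evaluation at $(z^\tau,\lambda^\tau)$. $\hat H^\tau=\mathrm{diag}(\hat H_0^\tau,\dots,\hat H_N^\tau)$ is a symmetric modification of $H^\tau$ with the same block diagonal structure, $\hat H_k=\begin{pmatrix}\hat Q_k&\hat S_k^T\\ \hat S_k&\hat R_k\end{pmatrix}$ for $k<N$, $\hat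 H_N=\hat Q_N$. Merit function, $\eta_1,\eta_2>0$: $\mathcal{L}_\eta=\mathcal{L}+\frac{\eta_1}{2}\|\nabla_\lambda\mathcal{L}\|^2+\frac{\eta_2}{2}\|\nabla_z\mathcal{L}\|^2$. FOTD: start at $(z^0,\lambda^0)$ with $x_0^0=\bar x_0$. Let $0=n_0<\dots<n_M=N$ be knots, $b\ge1$ an integer (overlap size), $m_1=m_1^i=\max\{n_i-b,0\}$, $m_2=m_2^i=\min\{n_{i+1}+b,N\}$, $i\in[M-1]$, $\mu>0$. At iteration $\tau$ (data evaluated at $(z^\tau,\lambda^\tau)$), subproblem $i$ is: minimize over $p_{m_1:m_2},q_{m_1:m_2-1}$ $$\sum_{k=m_1}^{m_2-1}\Big\{\tfrac12\begin{pmatrix}p_k\\ q_k\end{pmatrix}^T\hat H_k\begin{pmatrix}p_k\\ q_k\end{pmatrix}+\begin{pmatrix}\nabla_{x_k}\mathcal{L}\\ \nabla_{u_k}\mathcal{L}\end{pmatrix}^T\begin{pmatrix}p_k\\ q_k\end{pmatrix}\Big\}+\tfrac12p_{m_2}^T(\hat Q_{m_2}+\mu I)p_{m_2}+p_{m_2}^T\nabla_{x_{m_2}}\mathcal{L}$$ s.t. $p_{k+1}=A_kp_k+B_kq_k-\nabla_{\lambda_{k+1}}\mathcal{L}$, $k\in[m_1,m_2)$ (multiplier $\zeta_{k+1}$ on the residual $p_{k+1}-A_kp_k-B_kq_k+\nabla_{\lambda_{k+1}}\mathcal{L}$), and $p_{m_1}=0$ (multiplier $\zeta_{m_1}$); when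 $m_2=N$ the term $\mu I$ is omitted. For $\mu\ge\bar\mu$ it has a unique primal-dual solution, with stage components $\tilde w_{i,k}=(p_k;q_k)$ ($\tilde w_{i,m_2}=p_{m_2}$) and $\tilde\zeta_{i,k}=\zeta_k$. The direction is $\tilde\Delta z_k^\tau=\tilde w_{i,k}$, $\tilde\Delta\lambda_k^\tau=\tilde\zeta_{i,k}$ for $k\in[n_i,n_{i+1})$, and $\tilde\Delta z_N^\tau=\tilde w_{M-1,N}$, $\tilde\Delta\lambda_N^\tau=\tilde\zeta_{M-1,N}$. Update $(z^{\tau+1},\lambda^{\tau+1})=(z^\tau,\lambda^\tau)+\alpha_\tau(\tilde\Delta z^\tau,\tilde\Delta\lambda^\tau)$, where $\alpha_\tau\in(0,1]$ is found by backtracking line search (first element of $1,r,r^2,\dots$ for a fixed $r\in(0,1)$) so that the Armijo condition $\mathcal{L}_\eta^{\tau+1}\le\mathcal{L}_\eta^\tau+\beta\alpha_\tau(\nabla\mathcal{L}_\eta^\tau)^T(\tilde\Delta z^\tau;\tilde\Delta\lambda^\tau)$ holds, with fixed $\beta\in(0,1/2)$. Standing assumption: $(z^\tau,\lambda^\tau)\to(z^\star,\lambda^\star)$ as $\tau\to\infty$, where $\nabla\mathcal{L}(z^\star,\lambda^\star)=0$. Assumptions (constants independent of $\tau$). Reduced Hessian: for every $\tau$, if $Z^\tau$ has orthonormal columns spanning $\{w:G^\tau w=0\}$, then $(Z^\tau)^T\hat H^\tau Z^\tau\succeq\gamma_{RH}I$, $\gamma_{RH}>0$. Controllability: with $\Xi_{k,s}=(B_{k+s-1}\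 \ A_{k+s-1}B_{k+s-2}\ \cdots\ (A_{k+s-1}\cdots A_{k+1})B_k)$, there are $\gamma_C>0$ and an integer $t>0$ such that for every $\tau$ and $k\in[N-t]$ there is $t_k^\tau\in\{1,\dots,t\}$ with $\Xi^\tau_{k,t_k^\tau}(\Xi^\tau_{k,t_k^\tau})^T\succeq\gamma_C I$. Upper boundedness: $\max\{\|\hat H_k^\tau\|,\|A_k^\tau\|,\|B_k^\tau\|\}\le\Upsilon_{upper}$ for all $k,\tau$. Compactness: there is a compact set $\mathcal{Z}\times\Lambda$, $\mathcal{Z}=\mathcal{Z}_0\times\dots\times\mathcal{Z}_N$, $\Lambda=\Lambda_0\times\dots\times\Lambda_N$, with $(z^\tau+\alpha\tilde\Delta z^\tau,\lambda^\tau+\alpha\tilde\Delta\lambda^\tau)\in\mathcal{Z}\times\Lambda$ for all $\tau\ge0$, $\alpha\in[0,1]$; $g_k,f_k$ are thrice continuously differentiable; and $\max\{\sup_{\mathcal{Z}_k\times\Lambda_{k+1}}\|H_k\|,\sup_{\mathcal{Z}_k}\|A_k\|,\sup_{\mathcal{Z}_k}\|B_k\|\}\le\Upsilon_{upper}$ for all $k$ (for $k=N$: $\sup_{\mathcal{Z}_N}\|H_N\|\le\Upsilon_{upper}$). Here $\Upsilon_{upper}>1$. Vanishing Hessian modification: $\|H^\tau-\hat H^\tau\|\to0$. Local Lipschitz: there is $\Upsilon_L$ independent of $k$ such that for any $(z,\lambda),(z',\lambda')$ sufficiently close to $(z^\star,\lambda^\star)$, $\max\{\|A_k(z_k)-A_k(z_k')\|,\|B_k(z_k)-B_k(z_k')\|\}\le\Upsilon_L\|z_k-z_k'\|$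 and $\|H_k(z_k,\lambda_{k+1})-H_k(z_k',\lambda_{k+1}')\|\le\Upsilon_L\|(z_k-z_k';\lambda_{k+1}-\lambda'_{k+1})\|$ (for $k=N$ without $\lambda$). Constants: $\gamma_G=\Big(\frac{\gamma_C}{\gamma_C+\Upsilon_{upper}^{t+1}/(\Upsilon_{upper}-1)}\Big)^2\frac{\min\{1,\gamma_C\}}{(1+\Upsilon_{upper})^{2t}}$; $\Upsilon_{HG}>0$ is a constant with $\max\{\sup_{\mathcal{Z}\times\Lambda}\|H\|,\sup_{\mathcal{Z}}\|G\|\}\le\Upsilon_{HG}$; $\Upsilon_{KKT}>0$ is a constant with $\Big\|\begin{pmatrix}\hat H^\tau&(G^\tau)^T\\ G^\tau&0\end{pmatrix}^{-1}\Big\|\le\Upsilon_{KKT}$ for all $\tau$ (both exist under the assumptions); $\Upsilon=\max\{\Upsilon_{upper},\Upsilon_{KKT},\Upsilon_{HG}\}$. Errors: $\Psi_k^\tau=\|(z_k^\tau,\lambda_k^\tau)-(z_k^\star,\lambda_k^\star)\|$, $\Psi^\tau=\max_{k\in[N]}\Psi_k^\tau$. $o(\Psi^\tau)$ denotes a quantity of the form $\epsilon_\tau\Psi^\tau$ with $\epsilon_\tau\to0$ as $\tau\to\infty$. In the recursion for $i\in[M-2]$, $m_1=m_1^i,m_2=m_2^i$, and if $m_2=N$ the term with factor $\rho^{m_2-k}$ is absent. *)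

(* Defs.v *)
From HB Require Import structures.
From mathcomp Require Import all_boot all_order all_algebra.
From mathcomp Require Import all_classical all_reals all_analysis.

Set Implicit Arguments.
Unset Strict Implicit.
Unset Printing Implicit Defensive.

Import Order.TTheory GRing.Theory Num.Theory.
Import numFieldNormedType.Exports.

Local Open Scope classical_set_scope.
Local Open Scope ring_scope.

Section EuclideanCalculus.
Context {R : realType}.

Definition dot n (u v : 'cV[R]_n) : R := (u^T *m v) 0 0.

(* Euclidean norm; the library's `|v| on matrices is the sup norm. *)
Definition enorm n (v : 'cV[R]_n) : R := Num.sqrt (\sum_i v i 0 ^+ 2).

(* Spectral norm, i.e. the operator norm induced by [enorm]. *)
Definition opnorm m n (A : 'M[R]_(m, n)) : R :=
  sup [set enorm (A *m v) | v in [set v : 'cV[R]_n | enorm v <= 1]].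

(* Loewner order on symmetric matrices. *)
Definition loewner_le n (A B : 'M[R]_n) : Prop :=
  forall v : 'cV[R]_n, (v^T *m A *m v) 0 0 <= (v^T *m B *m v) 0 0.

(* Column-vector convention: row i of [jac F x] is the derivative of the i-th
   component of F (the library's jacobian acts on row vectors, and is the
   transpose of this one). *)
Definition jac n m (F : 'cV[R]_n -> 'cV[R]_m) (x : 'cV[R]_n) : 'M[R]_(m, n) :=
  \matrix_(i, j) ('D_(delta_mx j 0 : 'cV[R]_n) F x) i 0.

Definition grad n (phi : 'cV[R]_n -> R) (x : 'cV[R]_n) : 'cV[R]_n :=
  \col_j 'D_(delta_mx j 0 : 'cV[R]_n) (phi : 'cV[R]_n -> R^o) x.

Definition hess n (phi : 'cV[R]_n -> R) (x : 'cV[R]_n) : 'M[R]_n :=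
  jac (grad phi) x.

(* F is j times continuously differentiable. *)
Fixpoint Cdiff (j : nat) (V W : normedModType R) (F : V -> W) : Prop :=
  if j is j'.+1 then
    (forall x, differentiable F x) /\ (forall v, Cdiff j' (fun x => 'D_v F x))
  else continuous F.

End EuclideanCalculus.

(* Dimension of the control at stage k. The terminal stage N carries a
   zero-dimensional control, so that z_k = (x_k; u_k) for k < N and z_N = x_N
   are both vectors of length nx + cdim N nu k. *)
Definition cdim (N nu k : nat) : nat := if (k < N)%N then nu else 0%N.

(* The dynamic program: [cost P k] is g_k (k <= N) and [dyn P k] is f_k, which
   is only ever used for k < N. *)
Record nldp (R : realType) (N nx nu : nat) := Nldp {
  cost : forall k : nat, 'cV[R]_(nx + cdim N nu k) -> R;
  dyn : forall k : nat, 'cV[R]_(nx + cdim N nu k) -> 'cV[R]_nx;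
  xinit : 'cV[R]_nx
}.

(* The stacked vectors z = (z_0; ...; z_N) and lambda = (lambda_0; ...;
   lambda_N), with blocks accessed through [submxcol]. *)
Notation zdim N nx nu := (\sum_(k < N.+1) (nx + cdim N nu k))%N.
Notation ldim N nx := (\sum_(k < N.+1) nx)%N.
Notation zvec R N nx nu := 'cV[R]_(zdim N nx nu).
Notation lvec R N nx := 'cV[R]_(ldim N nx).

Section Problem.
Context {R : realType} {N nx nu : nat}.
Implicit Types (k : 'I_N.+1) (z w : zvec R N nx nu) (lam zeta : lvec R N nx).

Definition prv k : 'I_N.+1 := inord k.-1.
Definition nxt k : 'I_N.+1 := inord k.+1.

Definition stage z k : 'cV[R]_(nx + cdim N nu k) := submxcol z k.
Definition state z k : 'cV[R]_nx := usubmx (stage z k).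
Definition control z k : 'cV[R]_(cdim N nu k) := dsubmx (stage z k).
Definition dual lam k : 'cV[R]_nx := submxcol lam k.

Context (P : nldp R N nx nu).

Definition objective z : R := \sum_(k < N.+1) cost P (stage z k).

Definition constr z : lvec R N nx :=
  \mxcol_(k < N.+1)
    (state z k - (if (k == 0 :> nat)%N then xinit P
                  else dyn P (stage z (prv k)))).

Definition lagrangian z lam : R := objective z + dot lam (constr z).

Definition grad_z z lam : zvec R N nx nu := grad (lagrangian^~ lam) z.
Definition grad_l z lam : lvec R N nx := grad (lagrangian z) lam.

Definition Gmx z : 'M[R]_(ldim N nx, zdim N nx nu) := jac constr z.
Definition Amx k (y : 'cV[R]_(nx + cdim N nu k)) : 'M[R]_nx :=
  lsubmx (jac (@dyn _ _ _ _ P k) y).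
Definition Bmx k (y : 'cV[R]_(nx + cdim N nu k)) : 'M[R]_(nx, cdim N nu k) :=
  rsubmx (jac (@dyn _ _ _ _ P k) y).
Definition Hmx z lam : 'M[R]_(zdim N nx nu) := hess (lagrangian^~ lam) z.
Definition Hblock z lam k : 'M[R]_(nx + cdim N nu k) :=
  submxblock (Hmx z lam) k k.

(* Controllability matrix
   (B_{k+s-1}  A_{k+s-1} B_{k+s-2}  ...  (A_{k+s-1} ... A_{k+1}) B_k). *)
Definition Xi z (k s : nat) :=
  \mxrow_(j < s)
    ((\big[mulmx/1%:M]_(l < j)
        Amx (stage z (inord (k + s - l.+1)%N)))
     *m Bmx (stage z (inord (k + s - j.+1)%N))).

Definition merit (eta1 eta2 : R) z lam : R :=
  lagrangian z lam + eta1 / 2 * enorm (grad_l z lam) ^+ 2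
                   + eta2 / 2 * enorm (grad_z z lam) ^+ 2.

Definition grad_merit (eta1 eta2 : R) z lam
    : 'cV[R]_(zdim N nx nu + ldim N nx) :=
  grad (fun y => merit eta1 eta2 (usubmx y) (dsubmx y)) (col_mx z lam).

Definition kkt_matrix (Hh : 'M[R]_(zdim N nx nu)) z :
    'M[R]_(zdim N nx nu + ldim N nx) :=
  block_mx Hh (Gmx z)^T (Gmx z) 0.

(* Subproblem on the stages m1, ..., m2, with all data evaluated at (z, lam).
   Its variables (p; q) and multipliers zeta are stored in full-length vectors
   w and zeta, of which only p_{m1:m2}, q_{m1:m2-1} and zeta_{m1:m2} occur. *)
Section Subproblem.
Context (z : zvec R N nx nu) (lam : lvec R N nx).
Context (Hh : forall k : 'I_N.+1, 'M[R]_(nx + cdim N nu k)).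
Context (mu : R) (m1 m2 : nat).

Definition sub_objective w : R :=
  let e := inord m2 : 'I_N.+1 in
  let p := state w e in
  \sum_(k < N.+1 | (m1 <= k < m2)%N)
     (2^-1 * dot (stage w k) (Hh k *m stage w k)
      + dot (stage (grad_z z lam) k) (stage w k))
  + 2^-1 * dot p ((ulsubmx (Hh e) + (if m2 == N then 0 else mu%:M)) *m p)
  + dot p (state (grad_z z lam) e).

Definition sub_residual w k : 'cV[R]_nx :=
  state w (nxt k) - Amx (stage z k) *m state w k
  - Bmx (stage z k) *m control w k + dual (grad_l z lam) (nxt k).

Definition sub_feasible w : Prop :=
  state w (inord m1) = 0 /\
  forall k, (m1 <= k < m2)%N -> sub_residual w k = 0.

Definition sub_lagrangian w zeta : R :=
  sub_objective w + dot (dual zeta (inord m1)) (state w (inord m1))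
  + \sum_(k < N.+1 | (m1 <= k < m2)%N) dot (dual zeta (nxt k)) (sub_residual w k).

Definition sub_solution w zeta : Prop :=
  [/\ sub_feasible w,
      forall w', sub_feasible w' -> sub_objective w <= sub_objective w'
    & grad (sub_lagrangian^~ zeta) w = 0].

End Subproblem.

Section LineSearch.
Context (eta1 eta2 beta r : R).
Context (z : zvec R N nx nu) (lam : lvec R N nx).
Context (dz : zvec R N nx nu) (dlam : lvec R N nx).

Definition armijo (a : R) : Prop :=
  merit eta1 eta2 (z + a *: dz) (lam + a *: dlam)
  <= merit eta1 eta2 z lam
     + beta * a * dot (grad_merit eta1 eta2 z lam) (col_mx dz dlam).

Definition backtracking (a : R) : Prop :=
  exists j : nat, [/\ a = r ^+ j, armijo (r ^+ j)
    & forall l : nat, (l < j)%N -> ~ armijo (r ^+ l)].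

End LineSearch.

End Problem.

(* Left and right ends of the i-th overlapping interval (truncated subtraction
   implements max{n_i - b, 0}). *)
Definition m1 (n : nat -> nat) (b i : nat) : nat := (n i - b)%N.
Definition m2 (N : nat) (n : nat -> nat) (b i : nat) : nat :=
  minn (n i.+1 + b) N.

(* 0 = n_0 < n_1 < ... < n_M = N. *)
Definition knots (N M : nat) (n : nat -> nat) : Prop :=
  [/\ (0 < M)%N, n 0%N = 0%N, n M = N
    & forall i, (i < M)%N -> (n i < n i.+1)%N].

Section Algorithm.
Context {R : realType} {N nx nu : nat} (P : nldp R N nx nu).
Context (M : nat) (n : nat -> nat) (b : nat) (mu eta1 eta2 beta r : R).

(* Stage k belongs to [n_i, n_{i+1}), or to [n_{M-1}, n_M] when i = M-1. *)
Definition own_stage (i : nat) (k : 'I_N.+1) : bool :=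
  (n i <= k)%N && ((k < n i.+1)%N || (i.+1 == M)).

Definition fotd_direction (z : zvec R N nx nu) (lam : lvec R N nx)
    (Hh : forall k : 'I_N.+1, 'M[R]_(nx + cdim N nu k))
    (dz : zvec R N nx nu) (dlam : lvec R N nx) : Prop :=
  forall i, (i < M)%N -> exists w zeta,
    sub_solution P z lam Hh mu (m1 n b i) (m2 N n b i) w zeta /\
    forall k, own_stage i k ->
      stage dz k = stage w k /\ dual dlam k = dual zeta k.

Definition fotd_iterates (z : nat -> zvec R N nx nu) (lam : nat -> lvec R N nx)
    (Hh : nat -> forall k : 'I_N.+1, 'M[R]_(nx + cdim N nu k))
    (dz : nat -> zvec R N nx nu) (dlam : nat -> lvec R N nx)
    (alpha : nat -> R) : Prop :=
  state (z 0%N) ord0 = xinit P /\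
  forall tau : nat,
    [/\ fotd_direction (z tau) (lam tau) (Hh tau) (dz tau) (dlam tau),
        backtracking P eta1 eta2 beta r
          (z tau) (lam tau) (dz tau) (dlam tau) (alpha tau),
        z tau.+1 = z tau + alpha tau *: dz tau
      & lam tau.+1 = lam tau + alpha tau *: dlam tau].

End Algorithm.

Section Assumptions.
Context {R : realType} {N nx nu : nat} (P : nldp R N nx nu).
Context (z : nat -> zvec R N nx nu) (lam : nat -> lvec R N nx).
Context (Hh : nat -> forall k : 'I_N.+1, 'M[R]_(nx + cdim N nu k)).
Context (dz : nat -> zvec R N nx nu) (dlam : nat -> lvec R N nx).
Context (zs : zvec R N nx nu) (lams : lvec R N nx).

Definition Hhat (tau : nat) : 'M[R]_(zdim N nx nu) :=
  \mxdiag_(k < N.+1) Hh tau k.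

Definition hessian_modification_symmetric : Prop :=
  forall tau k, (Hh tau k)^T = Hh tau k.

Definition reduced_hessian (gRH : R) : Prop :=
  forall (tau s : nat) (Z : 'M[R]_(zdim N nx nu, s)),
    Z^T *m Z = 1%:M ->
    (forall w : zvec R N nx nu,
       Gmx P (z tau) *m w = 0 <-> exists v : 'cV[R]_s, w = Z *m v) ->
    loewner_le (gRH%:M) (Z^T *m Hhat tau *m Z).

Definition controllability (gC : R) (t : nat) : Prop :=
  forall tau k : nat, (k + t <= N)%N ->
    exists2 s : nat, (0 < s <= t)%N &
      loewner_le (gC%:M) (Xi P (z tau) k s *m (Xi P (z tau) k s)^T).

Definition upper_boundedness (Uup : R) : Prop :=
  forall (tau : nat) (k : 'I_N.+1),
    opnorm (Hh tau k) <= Uup /\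
    ((k < N)%N -> opnorm (Amx P (stage (z tau) k)) <= Uup /\
                  opnorm (Bmx P (stage (z tau) k)) <= Uup).

Definition smooth_data : Prop :=
  (forall k : nat, (k <= N)%N ->
     Cdiff 3 (cost P (k := k) : 'cV[R]_(nx + cdim N nu k) -> R^o)) /\
  (forall k : nat, (k < N)%N -> Cdiff 3 (dyn P (k := k))).

Section Compactness.
Context (Zk : forall k : 'I_N.+1, set 'cV[R]_(nx + cdim N nu k)).
Context (Lk : 'I_N.+1 -> set 'cV[R]_nx).

Definition Zset : set (zvec R N nx nu) := [set y | forall k, @Zk k (stage y k)].
Definition Lset : set (lvec R N nx) := [set l | forall k, Lk k (dual l k)].

(* H_k, the k-th diagonal block of H(z, lambda), depends on
   (z_k, lambda_{k+1}) only, so that its supremum over Z_k x Lambda_{k+1} is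
   the supremum over Z x Lambda. *)
Definition compactness (Uup : R) : Prop :=
  [/\ compact (Zset `*` Lset),
      forall (tau : nat) (a : R), 0 <= a <= 1 ->
        Zset (z tau + a *: dz tau) /\ Lset (lam tau + a *: dlam tau),
      forall (k : 'I_N.+1) y l, Zset y -> Lset l ->
        opnorm (Hblock P y l k) <= Uup
    & forall (k : 'I_N.+1) y, (k < N)%N -> @Zk k y ->
        opnorm (Amx P y) <= Uup /\ opnorm (Bmx P y) <= Uup].

Definition HG_bound (UHG : R) : Prop :=
  (forall y l, Zset y -> Lset l -> opnorm (Hmx P y l) <= UHG) /\
  (forall y, Zset y -> opnorm (Gmx P y) <= UHG).

End Compactness.

Definition KKT_bound (UKKT : R) : Prop :=
  forall tau : nat,
    kkt_matrix P (Hhat tau) (z tau) \in unitmx /\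
    opnorm (invmx (kkt_matrix P (Hhat tau) (z tau))) <= UKKT.

Definition vanishing_modification : Prop :=
  (fun tau => opnorm (Hmx P (z tau) (lam tau) - Hhat tau)) @ \oo --> (0 : R).

Definition local_lipschitz : Prop :=
  exists UL : R, exists2 d : R, 0 < d &
  forall (y y' : zvec R N nx nu) (l l' : lvec R N nx),
    enorm (col_mx (y - zs) (l - lams)) < d ->
    enorm (col_mx (y' - zs) (l' - lams)) < d ->
    forall k : 'I_N.+1,
      if (k < N)%N then
        [/\ opnorm (Amx P (stage y k) - Amx P (stage y' k))
              <= UL * enorm (stage y k - stage y' k),
            opnorm (Bmx P (stage y k) - Bmx P (stage y' k))
              <= UL * enorm (stage y k - stage y' k)
          & opnorm (Hblock P y l k - Hblock P y' l' k)
              <= UL * enorm (col_mx (stage y k - stage y' k)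
                                    (dual l (nxt k) - dual l' (nxt k)))]
      else opnorm (Hblock P y l k - Hblock P y' l' k)
             <= UL * enorm (stage y k - stage y' k).

End Assumptions.

Definition gammaG (R : realType) (gC Uup : R) (t : nat) : R :=
  (gC / (gC + Uup ^+ t.+1 / (Uup - 1))) ^+ 2
  * (Num.min 1 gC / (1 + Uup) ^+ (2 * t)).

Definition mubar (R : realType) (gC Uup : R) (t : nat) : R :=
  32 * Uup ^+ (4 * t).+1 / gC.

Definition overlap_condition (R : realType) (b : nat)
    (C1 rho eta1 eta2 beta : R) : Prop :=
  ln ((3 / 2 - beta) * C1 * eta1 / ((1 / 2 - beta) * eta2)) / ln (1 / rho)
  <= b%:R.

Section Errors.
Context {R : realType} {N nx nu : nat}.
Context (M : nat) (n : nat -> nat) (b : nat).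
Context (z : nat -> zvec R N nx nu) (lam : nat -> lvec R N nx).
Context (zs : zvec R N nx nu) (lams : lvec R N nx).

Definition stage_error (tau : nat) (k : 'I_N.+1) : R :=
  enorm (col_mx (stage (z tau) k - stage zs k)
                (dual (lam tau) k - dual lams k)).

Definition error (tau : nat) : R :=
  \big[Num.max/0]_(k < N.+1) stage_error tau k.

Definition error_recursion (C1 rho : R) : Prop :=
  exists2 eps : nat -> R, eps @ \oo --> (0 : R) &
  \forall tau \near \oo,
    (forall (i : nat) (k : 'I_N.+1), (i.+1 < M)%N -> (n i <= k < n i.+1)%N ->
       let m1 := m1 n b i in let m2 := m2 N n b i in
       stage_error tau.+1 k <= eps tau * error tau
         + C1 * (rho ^+ (k - m1)
                   * enorm (state (z tau) (inord m1) - state zs (inord m1))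
                 + (if (m2 < N)%N then
                      rho ^+ (m2 - k)
                      * enorm (col_mx
                          (stage (z tau) (inord m2) - stage zs (inord m2))
                          (dual (lam tau) (inord m2.+1)
                           - dual lams (inord m2.+1)))
                    else 0))) /\
    (forall k : 'I_N.+1, (n M.-1 <= k)%N ->
       let m1 := m1 n b M.-1 in
       stage_error tau.+1 k <= eps tau * error tau
         + C1 * (rho ^+ (k - m1)
                   * enorm (state (z tau) (inord m1) - state zs (inord m1)))).

End Errors.

(* Main.v *)
Require Import Defs.
From HB Require Import structures.
From mathcomp Require Import all_boot all_order all_algebra.
From mathcomp Require Import all_classical all_reals all_analysis.
From mathcomp Require Import zify lra.
Import Order.TTheory GRing.Theory Num.Theory.
Import numFieldNormedType.Exports.
Local Open Scope classical_set_scope.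
Local Open Scope ring_scope.

Set Implicit Arguments.
Unset Strict Implicit.

(** The claim is bookkeeping on top of the two-sided error recursion.  For a
    stage [k] owned by subproblem [i], the recursion bounds the next error by
    the errors at the two ends of the overlapping interval [[m1, m2]], damped
    by the distance from [k] to each end.  An end strictly inside the
    horizon lies at distance at least [b] from [k], so its damping factor is at
    most [rho ^+ b].  An end that coincides with a boundary of the horizon may
    be closer, but contributes nothing: at the right boundary the recursion has
    no term, and at the left boundary the error vanishes, because subproblem
    [0] imposes a zero step on the initial state, so that every iterate, and
    hence the limit, satisfies the initial condition
    ([fotd_initial_state], [limit_initial_state]).

    The left end contributes at most [rho ^+ b] times the error.  The right end
    mixes the primal error of stage [m2] with the dual error of stage
    [m2.+1]; as each is at most the error, their joint norm is at most
    [sqrt 2], hence [3 / 2], times the error ([enorm_col_mx_le]).  The sum is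
    at most [5 / 2 * C1 * rho ^+ b] times the error, and the remaining half of
    [C1 * rho ^+ b] absorbs the vanishing coefficient of the little-o term
    ([stage_errors_le]). *)

(** * Euclidean norm of stacked vectors *)

Section EuclideanNorm.
Context {R : realType}.

Lemma enorm_ge0 n (v : 'cV[R]_n) : 0 <= enorm v.
Proof. exact: sqrtr_ge0. Qed.

Lemma sqr_enorm n (v : 'cV[R]_n) : enorm v ^+ 2 = \sum_i v i 0 ^+ 2.
Proof. by rewrite sqr_sqrtr // sumr_ge0 // => i _; rewrite sqr_ge0. Qed.

Lemma enorm0 n : enorm (0 : 'cV[R]_n) = 0.
Proof. by rewrite /enorm big1 ?sqrtr0 // => i _; rewrite mxE expr0n. Qed.

Lemma sqr_enorm_col_mx m n (u : 'cV[R]_m) (v : 'cV[R]_n) :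
  enorm (col_mx u v) ^+ 2 = enorm u ^+ 2 + enorm v ^+ 2.
Proof.
rewrite !sqr_enorm big_split_ord /=; congr (_ + _).
  by apply: eq_bigr => i _; rewrite col_mxEu.
by apply: eq_bigr => i _; rewrite col_mxEd.
Qed.

Lemma enorm_le_col_mxl m n (u : 'cV[R]_m) (v : 'cV[R]_n) :
  enorm u <= enorm (col_mx u v).
Proof.
by rewrite -ler_sqr ?nnegrE ?enorm_ge0 // sqr_enorm_col_mx lerDl sqr_ge0.
Qed.

Lemma enorm_le_col_mxr m n (u : 'cV[R]_m) (v : 'cV[R]_n) :
  enorm v <= enorm (col_mx u v).
Proof.
by rewrite -ler_sqr ?nnegrE ?enorm_ge0 // sqr_enorm_col_mx lerDr sqr_ge0.
Qed.

(** The sharp constant is [sqrt 2]; a rational bound below [2] is enough to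
    leave room for the little-o term of the recursion. *)
Lemma enorm_col_mx_le m n (u : 'cV[R]_m) (v : 'cV[R]_n) (c : R) :
  enorm u <= c -> enorm v <= c -> enorm (col_mx u v) <= 3 / 2 * c.
Proof.
move=> uc vc; have c_ge0 := le_trans (enorm_ge0 u) uc.
have u2 : enorm u ^+ 2 <= c ^+ 2 by rewrite ler_sqr ?nnegrE ?enorm_ge0.
have v2 : enorm v ^+ 2 <= c ^+ 2 by rewrite ler_sqr ?nnegrE ?enorm_ge0.
rewrite -ler_sqr ?nnegrE ?enorm_ge0 //; last by lra.
rewrite sqr_enorm_col_mx; have := sqr_ge0 c; nra.
Qed.

End EuclideanNorm.

(** * Stage errors *)

Section StageErrors.
Context {R : realType} {N nx nu : nat}.
Context (z : nat -> zvec R N nx nu) (lam : nat -> lvec R N nx).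
Context (zs : zvec R N nx nu) (lams : lvec R N nx).

Lemma stage_error_le_error tau k :
  stage_error z lam zs lams tau k <= error z lam zs lams tau.
Proof. exact: (le_bigmax 0 (stage_error z lam zs lams tau)). Qed.

Lemma error_ge0 tau : 0 <= error z lam zs lams tau.
Proof. exact: le_trans (enorm_ge0 _) (stage_error_le_error tau ord0). Qed.

Lemma stage_diff_le_error tau k :
  enorm (stage (z tau) k - stage zs k) <= error z lam zs lams tau.
Proof. exact: le_trans (enorm_le_col_mxl _ _) (stage_error_le_error tau k). Qed.

Lemma dual_diff_le_error tau k :
  enorm (dual (lam tau) k - dual lams k) <= error z lam zs lams tau.
Proof. exact: le_trans (enorm_le_col_mxr _ _) (stage_error_le_error tau k). Qed.

Lemma state_diff_le_error tau k :
  enorm (state (z tau) k - state zs k) <= error z lam zs lams tau.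
Proof.
apply: le_trans (stage_diff_le_error tau k).
rewrite /state -linearB -{2}[stage _ _ - _]vsubmxK.
exact: enorm_le_col_mxl.
Qed.

End StageErrors.

(** * The initial state *)

Lemma state_step (R : realType) (N nx nu : nat) (z dz : zvec R N nx nu) (a : R)
    (k : 'I_N.+1) : state (z + a *: dz) k = state z k + a *: state dz k.
Proof. by apply/matrixP => i j; rewrite !mxE. Qed.

(** Stage [0] is the left end of subproblem [0], where the step is constrained
    to be zero; the initial condition is therefore preserved whatever the step
    length. *)
Lemma fotd_initial_state (R : realType) (N nx nu : nat) (P : nldp R N nx nu)
    (M : nat) (n : nat -> nat) (b : nat) (mu eta1 eta2 beta r : R)
    (z : nat -> zvec R N nx nu) (lam : nat -> lvec R N nx)
    (Hh : nat -> forall k : 'I_N.+1, 'M[R]_(nx + cdim N nu k))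
    (dz : nat -> zvec R N nx nu) (dlam : nat -> lvec R N nx)
    (alpha : nat -> R) :
  knots N M n ->
  fotd_iterates P M n b mu eta1 eta2 beta r z lam Hh dz dlam alpha ->
  forall tau, state (z tau) ord0 = xinit P.
Proof.
move=> [M_gt0 n0 _ n_incr] [z0 iter]; elim=> [//|tau IH].
have [dir _ -> _] := iter tau.
have [w [zeta [[[w_m1 _] _ _] own]]] := dir 0%N M_gt0.
rewrite state_step IH.
have [dz0 _] : stage (dz tau) ord0 = stage w ord0 /\
    dual (dlam tau) ord0 = dual zeta ord0.
  by apply: own; rewrite /own_stage n0 /= -{1}n0 n_incr.
have m1E : inord (m1 n b 0) = ord0 :> 'I_N.+1.
  by apply: val_inj; rewrite /m1 n0 sub0n /= inordK.
by rewrite /state dz0 -/(state w ord0) -m1E w_m1 scaler0 addr0.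
Qed.

Lemma limit_initial_state (R : realType) (N nx nu : nat)
    (z : nat -> zvec R N nx nu) (zs : zvec R N nx nu) (x : 'cV[R]_nx) :
  z @ \oo --> zs -> (forall tau, state (z tau) ord0 = x) ->
  state zs ord0 = x.
Proof.
move=> z_cvg zE; apply/matrixP => i j.
pose l : 'I_(zdim N nx nu) :=
  @tagnat.Rank _ (fun k : 'I_N.+1 => (nx + cdim N nu k)%N) ord0
    (lshift (cdim N nu (ord0 : 'I_N.+1)) i).
have coordE (y : zvec R N nx nu) : state y ord0 i j = y l j by rewrite !mxE.
rewrite coordE.
have c1 : (fun tau => z tau l j) @ \oo --> (zs l j : R).
  exact: cvg_comp z_cvg (@coord_continuous _ _ _ l j zs).
have c2 : (fun tau => z tau l j) @ \oo --> (x i j : R).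
  have -> : (fun tau => z tau l j) = fun=> x i j.
    by apply/funext => tau; rewrite -coordE zE.
  exact: cvg_cst.
exact: (norm_cvg_unique c1 c2).
Qed.

(** * Contraction of the error *)

Lemma knot_interval (N M : nat) (n : nat -> nat) (k : nat) :
  knots N M n ->
  (exists2 i, (i.+1 < M)%N & (n i <= k < n i.+1)%N) \/ (n M.-1 <= k)%N.
Proof.
move=> [_ n0 _ _].
suff H m : (exists2 i, (i < m)%N & (n i <= k < n i.+1)%N) \/ (n m <= k)%N.
  by have [[i iM ki]|] := H M.-1; [left; exists i => //; lia | right].
elim: m => [|m IH]; first by right; rewrite n0.
have [|k_lt] := leqP (n m.+1) k; first by right.
by left; have [[i im ki]|mk] := IH; [exists i => //; lia | exists m => //; lia].
Qed.

Section Contraction.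
Context {R : realType} {N nx nu : nat}.
Context (M : nat) (n : nat -> nat) (b : nat) (C1 rho : R).
Context (z : nat -> zvec R N nx nu) (lam : nat -> lvec R N nx).
Context (zs : zvec R N nx nu) (lams : lvec R N nx).
Hypothesis rho01 : 0 <= rho <= 1.

Local Notation Psi := (error z lam zs lams).

(** When the overlap is cut at stage [0], the stage [k] may be closer than [b]
    to the left end, but then the left end carries no error. *)
Lemma left_end_le tau i (k : nat) :
  state (z tau) ord0 = state zs ord0 -> (n i <= k)%N ->
  rho ^+ (k - m1 n b i)
    * enorm (state (z tau) (inord (m1 n b i)) - state zs (inord (m1 n b i)))
  <= rho ^+ b * Psi tau.
Proof.
move=> z0 nik; have /andP[rho0 rho1] := rho01.
have [bni|nib] := leqP b (n i).
  apply: ler_pM; rewrite ?exprn_ge0 ?enorm_ge0 ?state_diff_le_error //.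
  by apply: ler_wiXn2l => //; rewrite /m1; lia.
have -> : inord (m1 n b i) = ord0 :> 'I_N.+1.
  by apply: val_inj; rewrite /m1 (eqP (ltnW nib)) /= inordK.
by rewrite z0 subrr enorm0 mulr0 mulr_ge0 ?exprn_ge0 ?error_ge0.
Qed.

Lemma right_end_le tau i (k : nat) :
  (k < n i.+1)%N ->
  (if (m2 N n b i < N)%N then
     rho ^+ (m2 N n b i - k)
     * enorm (col_mx
         (stage (z tau) (inord (m2 N n b i)) - stage zs (inord (m2 N n b i)))
         (dual (lam tau) (inord (m2 N n b i).+1)
          - dual lams (inord (m2 N n b i).+1)))
   else 0)
  <= 3 / 2 * (rho ^+ b * Psi tau).
Proof.
move=> kn; have /andP[rho0 rho1] := rho01.
case: ifP => [m2N|_]; last first.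
  by rewrite mulr_ge0 ?mulr_ge0 ?exprn_ge0 ?error_ge0.
rewrite mulrCA; apply: ler_pM; rewrite ?exprn_ge0 ?enorm_ge0 //.
  by apply: ler_wiXn2l => //; move: m2N; rewrite /m2; lia.
exact: enorm_col_mx_le (stage_diff_le_error _ _ _ _ _ _)
  (dual_diff_le_error _ _ _ _ _ _).
Qed.

(** Both ends together cost [5 / 2], which leaves [1 / 2] of the constant [3]
    for the little-o term. *)
Lemma stage_errors_le :
  0 < C1 -> 0 < rho -> knots N M n ->
  (forall tau, state (z tau) ord0 = state zs ord0) ->
  error_recursion M n b z lam zs lams C1 rho ->
  \forall tau \near \oo, forall k,
    stage_error z lam zs lams tau.+1 k <= 3 * C1 * rho ^+ b * Psi tau.
Proof.
move=> C1_gt0 rho_gt0 kn z0 [eps eps0 rec].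
have half_gt0 : 0 < 1 / 2 * (C1 * rho ^+ b).
  by rewrite !mulr_gt0 ?exprn_gt0 ?divr_gt0.
apply: filterS2 rec (cvgr_le _ eps0 _ half_gt0) => tau.
move=> [rec_mid rec_last] eps_small k.
have eps_le : eps tau * Psi tau <= 1 / 2 * (C1 * rho ^+ b) * Psi tau.
  by rewrite ler_wpM2r ?error_ge0.
have := error_ge0 z lam zs lams tau; set psi := Psi tau in eps_le * => psi_ge0.
have c_ge0 : 0 <= C1 * (rho ^+ b * psi).
  by rewrite !mulr_ge0 ?exprn_ge0 // ltW.
have [[i iM /[dup] ki /andP[nik kni]]|last_k] := knot_interval k kn.
  apply: le_trans (rec_mid i k iM ki) _.
  have := lerD (left_end_le (z0 tau) nik) (right_end_le tau kni).
  move=> /(ler_wpM2l (ltW C1_gt0)); rewrite -/psi => ends_le.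
  apply: le_trans (lerD eps_le ends_le) _; lra.
apply: le_trans (rec_last k last_k) _.
have := left_end_le (z0 tau) last_k.
move=> /(ler_wpM2l (ltW C1_gt0)); rewrite -/psi => end_le.
apply: le_trans (lerD eps_le end_le) _; lra.
Qed.

End Contraction.

Unset Implicit Arguments.
Set Strict Implicit.

Theorem theorem6p3 (R : realType) (N nx nu : nat) (P : nldp R N nx nu)
  (* temporal decomposition *)
  (M : nat) (n : nat -> nat) (mu : R)
  (* constants of the assumptions *)
  (gRH gC Uup UKKT UHG : R) (t : nat)
  (Zk : forall k : 'I_N.+1, set 'cV[R]_(nx + cdim N nu k))
  (Lk : 'I_N.+1 -> set 'cV[R]_nx)
  (* constants of the error recursion *)
  (C1 rho : R)
  (* overlap size *)
  (b : nat)
  (* merit function and line search parameters *)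
  (eta1 eta2 beta r : R)
  (* iterates and their limit *)
  (z : nat -> zvec R N nx nu) (lam : nat -> lvec R N nx)
  (Hh : nat -> forall k : 'I_N.+1, 'M[R]_(nx + cdim N nu k))
  (dz : nat -> zvec R N nx nu) (dlam : nat -> lvec R N nx)
  (alpha : nat -> R)
  (zs : zvec R N nx nu) (lams : lvec R N nx) :
  knots N M n -> (1 <= b)%N -> (0 < t)%N ->
  0 < gRH -> 0 < gC -> 1 < Uup -> 0 < UKKT -> 0 < UHG ->
  0 < eta1 -> 0 < eta2 -> 0 < beta < 1 / 2 -> 0 < r < 1 ->
  0 < C1 -> 0 < rho < 1 ->
  (* the FOTD iterates, converging to a KKT point *)
  hessian_modification_symmetric Hh ->
  fotd_iterates P M n b mu eta1 eta2 beta r z lam Hh dz dlam alpha ->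
  z @ \oo --> zs -> lam @ \oo --> lams ->
  grad_z P zs lams = 0 -> grad_l P zs lams = 0 ->
  (* assumptions *)
  reduced_hessian P z Hh gRH ->
  controllability P z gC t ->
  upper_boundedness P z Hh Uup ->
  smooth_data P ->
  compactness P z lam dz dlam Zk Lk Uup ->
  vanishing_modification P z lam Hh ->
  local_lipschitz P zs lams ->
  HG_bound P Zk Lk UHG ->
  KKT_bound P z Hh UKKT ->
  (* parameter choices *)
  mubar gC Uup t <= mu ->
  17 / (eta2 * gammaG gC Uup t) <= eta1 ->
  eta2 <= gRH / (12 * Num.max Uup (Num.max UKKT UHG) ^+ 2) ->
  (* defining property of C1 and rho *)
  (overlap_condition b C1 rho eta1 eta2 beta ->
     error_recursion M n b z lam zs lams C1 rho) ->
  overlap_condition b C1 rho eta1 eta2 beta ->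
  \forall tau \near \oo,
    error z lam zs lams tau.+1 <= 3 * C1 * rho ^+ b * error z lam zs lams tau.
Proof.
move=> kn _ _ _ _ _ _ _ _ _ _ _ C1_gt0 /andP[rho_gt0 rho_lt1] _ iter z_cvg _.
move=> _ _ _ _ _ _ _ _ _ _ _ _ _ _ rec b_large.
have z0 := fotd_initial_state kn iter.
have zs0 := limit_initial_state z_cvg z0.
have rho01 : 0 <= rho <= 1 by rewrite !ltW.
have z0s tau : state (z tau) ord0 = state zs ord0 by rewrite z0 zs0.
have := stage_errors_le rho01 C1_gt0 rho_gt0 kn z0s (rec b_large).
apply: filterS => tau stage_le; apply: bigmax_le => [|k _]; last exact: stage_le.
by rewrite !mulr_ge0 ?exprn_ge0 ?error_ge0 // ltW.
Qed.
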